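(* Let $p\geq 5$ be a prime and let $d_1, d_2$ be positive integers with $1\leq d_1\leq p-2$, $1\leq d_2\leq p-2$ and $d_1\neq d_2$. Then $$\mu_p(d_1,d_2)\leq \frac{p-1}{2}.$$
   Context: For a prime $p$ and positive integers $d_1\neq d_2$ with $1\le d_1,d_2\le p-2$, define $$\mu_p(d_1,d_2)=\min\{\, i+j \;:\; i,j\in\mathbb{Z},\ 0\leq i,j<p,\ (i,j)\neq(0,0),\ d_1 i+d_2 j\equiv 0 \pmod{p-1}\,\}.$$ *)

(* Defs.v *)
From mathcomp Require Import all_boot.

Set Implicit Arguments.
Unset Strict Implicit.
Unset Printing Implicit Defensive.

Definition mu_sol (p d1 d2 i j : nat) : bool :=
  [&& i < p, j < p, (i, j) != (0, 0) & d1 * i + d2 * j == 0 %[mod p - 1]].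

Definition mu_val (p d1 d2 : nat) : pred nat :=
  fun k => [exists i : 'I_p, exists j : 'I_p, mu_sol p d1 d2 i j && (k == i + j)].

(* [(p - 1, 0)] is always a solution, so the minimum below exists for every
   prime [p]. *)
Lemma mu_val_ex (p d1 d2 : nat) : prime p -> exists k, mu_val p d1 d2 k.
Proof.
move=> /prime_gt1; case: p => [|[|q]] // _; exists q.+1.
apply/existsP; exists ord_max; apply/existsP; exists ord0.
by rewrite /mu_sol /= subn1 muln0 !addn0 modnMl mod0n ltnSn !eqxx.
Qed.

Definition mu (p d1 d2 : nat) (hp : prime p) : nat :=
  ex_minn (mu_val_ex d1 d2 hp).

(* Main.v *)
Require Import Defs.
From mathcomp Require Import all_boot.
From mathcomp Require Import zify.

(** Put [n = p - 1], which is even. If some [d] among [d1], [d2] shares a factor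
    with [n], its additive order modulo [n] is a proper divisor of [n], hence at
    most [n / 2], and that multiple of [d] alone is a solution
    ([short_multiple]).

    Otherwise both are units modulo [n], and multiplying by the inverse of [d1]
    reduces the congruence to [i + d * j = 0] with [d] a unit different from
    [1]. As [n] is even, [d] is odd, so [3 <= d < n]. If [d] exceeds [n / 2],
    the solution [(n - d, 1)] is short; if not, Euclidean division
    [n = q * d + r] gives the solution [(r, q)], and [q + r <= n / 2] amounts to
    [r <= q * (d - 2)], which follows from [r < d], [2 <= q] and [3 <= d]
    ([short_relation_one]). *)

Lemma short_multiple (n d : nat) : 0 < n -> ~~ coprime n d ->
  exists i, [/\ 0 < i, i.*2 <= n & n %| d * i].
Proof.
move=> n_gt0 ncop; set g := gcdn n d.
have g_gt0 : 0 < g by rewrite gcdn_gt0 n_gt0.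
have g_gt1 : 1 < g by rewrite ltn_neqAle eq_sym ncop.
have gn : n %/ g * g = n by rewrite divnK ?dvdn_gcdl.
exists (n %/ g); split.
- by rewrite divn_gt0 // dvdn_leq ?dvdn_gcdl.
- by rewrite -{2}gn -muln2 leq_mul2l g_gt1 orbT.
(* Both [n] and [d] are multiples of [g], so [d * (n / g) = (d / g) * n]. *)
- by rewrite /g gcdnC muln_divCA_gcd dvdn_mulr.
Qed.

Lemma short_relation_one (n d : nat) : 2 < d < n -> ~~ odd n -> odd d ->
  exists i j, [/\ 0 < i + j, (i + j).*2 <= n & n %| i + d * j].
Proof.
move=> /andP[d_gt2 d_ltn] n_even d_odd.
have [d_big | d_small] := ltnP n d.*2.
  exists (n - d), 1; split; [by rewrite addn1 | | by rewrite muln1 subnK ?(ltnW d_ltn)].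
  (* [n < 2 * d] improves to [n + 2 <= 2 * d] because [n] is even. *)
  lia.
have q_ge2 : 2 <= n %/ d by rewrite leq_divRL ?mul2n //; lia.
have r_ltd : n %% d < d by rewrite ltn_mod; lia.
have n_eq := divn_eq n d.
exists (n %% d), (n %/ d); split; first by lia.
  nia.
by rewrite addnC mulnC -n_eq.
Qed.

(** Invertibility of [d1] makes the congruence equivalent to one whose first
    coefficient is [1]; a short solution of the latter is a solution of the
    former since [d1 * (i + d * j)] is congruent to [d1 * i + d2 * j]. *)
Lemma short_relation_coprime (n d1 d2 : nat) :
  0 < n -> ~~ odd n -> coprime n d1 -> coprime n d2 -> d1 != d2 %[mod n] ->
  exists i j, [/\ 0 < i + j, (i + j).*2 <= n & n %| d1 * i + d2 * j].
Proof.
move=> n_gt0 n_even cop1 cop2 d12.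
have n_gt1 : 1 < n.
  by case: n n_gt0 d12 {n_even cop1 cop2} => [|[|n]] //; rewrite !modn1.
have d1_gt0 : 0 < d1.
  by case: d1 cop1 {d12} => //; rewrite /coprime gcdn0 gtn_eqF.
have [u v uv _] := egcdnP n d1_gt0.
have ud1 : u * d1 = 1 %[mod n].
  by rewrite uv gcdnC (eqP cop1) modnMDl.
have cop_u : coprime n u.
  have : coprime n (u * d1) by rewrite -coprime_modr ud1 coprime_modr coprimen1.
  by rewrite coprimeMr => /andP[].
pose d := (u * d2) %% n.
have d_ltn : d < n by rewrite ltn_mod.
have d1d : d1 * d = d2 %[mod n].
  by rewrite modnMmr mulnA (mulnC d1) -modnMml ud1 modnMml mul1n.
have d_neq1 : d != 1.
  by apply: contraNneq d12 => d1E; rewrite -d1d d1E muln1.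
have cop_d : coprime n d by rewrite coprime_modr coprimeMr cop_u.
have d_odd : odd d.
  rewrite -[odd d]negbK -dvdn2; apply/negP => d_even.
  have : 2 %| gcdn n d by rewrite dvdn_gcd d_even dvdn2 n_even.
  by rewrite (eqP cop_d).
have d_gt2 : 2 < d by case: (d) d_odd d_neq1 => [|[|[|]]].
have [|i [j [pos short div]]] := @short_relation_one n d _ n_even d_odd.
  by rewrite d_gt2.
exists i, j; split=> //; rewrite /dvdn.
rewrite -modnDmr -[(d2 * j) %% n]modnMml -d1d modnMml modnDmr -mulnA -mulnDr.
exact: dvdn_mull.
Qed.

Lemma short_relation (n d1 d2 : nat) :
  0 < n -> ~~ odd n -> d1 != d2 %[mod n] ->
  exists i j, [/\ 0 < i + j, (i + j).*2 <= n & n %| d1 * i + d2 * j].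
Proof.
move=> n_gt0 n_even d12.
have [cop1 | /(short_multiple _ _ n_gt0)[i [? ? ?]]] := boolP (coprime n d1); last first.
  by exists i, 0; rewrite addn0 muln0 addn0.
have [cop2 | /(short_multiple _ _ n_gt0)[j [? ? ?]]] := boolP (coprime n d2); last first.
  by exists 0, j; rewrite muln0.
exact: short_relation_coprime.
Qed.

Lemma mu_le (p d1 d2 i j : nat) (hp : prime p) :
  mu_sol p d1 d2 i j -> mu d1 d2 hp <= i + j.
Proof.
move=> sol; have /and4P[ip jp _ _] := sol.
rewrite /mu; case: ex_minnP => m _; apply.
by apply/existsP; exists (Ordinal ip); apply/existsP; exists (Ordinal jp); rewrite sol /=.
Qed.

Theorem theorem2p1 (p d1 d2 : nat) (hp : prime p) (hp5 : 5 <= p)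
  (hd1 : 1 <= d1 <= p - 2) (hd2 : 1 <= d2 <= p - 2) (hd12 : d1 <> d2) :
  mu d1 d2 hp <= (p - 1) %/ 2.
Proof.
have p_odd : odd p by have [pE | //] := even_prime hp; rewrite pE in hp5.
have n_gt0 : 0 < p - 1 by lia.
have n_even : ~~ odd (p - 1) by lia.
have d12 : d1 != d2 %[mod p - 1].
  by rewrite !modn_small; [apply/eqP | lia | lia].
have [i [j [pos short div]]] := short_relation _ _ _ n_gt0 n_even d12.
apply: (@leq_trans (i + j)); last by rewrite leq_divRL // muln2.
apply: mu_le; apply/and4P; split; [lia | lia | | by rewrite mod0n].
by apply: contraTneq pos => -[-> ->].
Qed.
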